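(* Let $V$ be a uniformly convex and uniformly smooth Banach space, let $V=\sum_{j=1}^N V_j$ with closed subspaces $V_j$, let $\epsilon>0$, and let $F = F_0 + \epsilon F_1$, where $F_0, F_1 \colon V \to \mathbb{R}$ are G\^{a}teaux differentiable and convex, $F_0$ is semicoercive with respect to a seminorm $|\cdot|$ on $V$ with kernel $\mathcal{N} = \ker|\cdot|$, and $F_1$ is coercive. Suppose that: (Kernel decomposition) $\mathcal{N} = \sum_{j=1}^N (V_j \cap \mathcal{N})$; (Triangle inequality-like property) for any bounded convex subset $K \subset V$ there is a constant $C_{K,\mathrm{tri}}>0$ such that $d_{1,j}(v_j+w_j;v) \le C_{K,\mathrm{tri}}\bigl(d_{1,j}(v_j;v)+d_{1,j}(w_j;v)\bigr)$ for all $v \in K$, $v_j,w_j \in V_j$, $j \in \{1,\dots,N\}$; (Local smoothness) for some $q>1$ and every $j \in \{1,\dots,N\}$: for any $\|\cdot\|$-bounded convex subset $K \subset V$ and any $\|\cdot\|$-bounded convex subset $K_j \subset V_j$ with $0 \in K_j$, $\sup_{v\in K, w_j \in K_j} d_{0,j}(w_j;v)/\|w_j\|^q<\infty$ and $\sup_{v\in K, w_j \in K_j} d_{1,j}(w_j;v)/\|w_j\|^q<\infty$. Given $u^{(0)} \in V$, let $K_0 = \{v \in V : F(v) \le F(u^{(0)})\}$ and $$C_{K_0} := q \sup_{v, v+w \in K_0}\ \inf_{\sum_{j=1}^N w_j = w,\ w_j \in V_j} \frac{\sum_{j=1}^N d_j(w_j;v)}{\|w\|_{\epsilon,q}^q}.$$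 Then $C_{K_0}$ has an upper bound independent of $\epsilon$ (except for the possible dependence on $\epsilon$ through $K_0$). More precisely, $$C_{K_0} \leq q C_q \sup_{\substack{v \in K_0,\ \phi \in \mathcal{N},\ \xi \in J^* \mathcal{N}^{\circ}, \\ v+ \phi+\xi \in K_0}} \Bigg[ C_q C_{K_0, \mathrm{tri}} \inf_{\sum_{j=1}^N \phi_j = \phi} \frac{\sum_{j=1}^N d_{1,j} (\phi_j; v)}{\| \phi \|^q} + \inf_{\sum_{j=1}^N \xi_j = \xi} \left( \frac{\sum_{j=1}^N d_{0,j} (\xi_j; v)}{| \xi |^q} + C_q C_{K_0, \mathrm{tri}} \frac{\sum_{j=1}^N d_{1,j} (\xi_j; v)}{\| \xi \|^q } \right) \Bigg] < \infty,$$ where each $\phi_j$ is taken from $V_j \cap \mathcal{N}$ and each $\xi_j$ from $V_j$.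
   Context: Semicoercivity with respect to a seminorm: $F_0$ is semicoercive with respect to $|\cdot|$ if $|\cdot|$ is a continuous seminorm on $V$ such that, with $\ker|\cdot| = \{v \in V : |v| = 0\}$, there is a constant $C'>0$ with $\inf_{\phi \in \ker|\cdot|} \|v+\phi\| \le C'|v|$ for all $v \in V$; $F_0(v)=F_0(v+\phi)$ for all $v \in V$, $\phi \in \ker|\cdot|$; and $F_0(v) \to \infty$ as $|v| \to \infty$. Coercive means $F_1(v)\to\infty$ as $\|v\|\to\infty$. For $i \in \{0,1\}$, $v \in V$, $w_j \in V_j$: $d_{i,j}(w_j;v) = F_i(v+w_j)-F_i(v)-\langle F_i'(v),w_j\rangle$, and $d_j(w_j;v) = d_{0,j}(w_j;v)+\epsilon\, d_{1,j}(w_j;v)$. The norm $\|\cdot\|_{\epsilon,q}$ is $\|v\|_{\epsilon,q} = (|v|^q+\epsilon\|v\|^q)^{1/q}$. Duality mappings: $J^* \colon V^* \to V$ is the normalized duality mapping on $V^*$, i.e. $J^*(v^* )$ is the unique $v \in V$ with $\langle v^*,v\rangle = \|v^*\|\|v\|$ and $\|v\|=\|v^*\|$ (single-valued and bijective under the assumptions on $V$). For a closed subspace $\mathcal{M}\subset V$, $\mathcal{M}^\circ = \{v^* \in V^* : \langle v^*,v\rangle=0 \ \forall v \in \mathcal{M}\}$. Every $v \in V$ is uniquely $v=\phi+\xi$ with $\phi\in\mathcal{M}$, $\xi\in J^*\mathcal{M}^\circ$. $C_q>0$ is a constant depending only on $q$ such that $\|\phi\|^q+\|\xi\|^q \le C_q\|\phi+\xi\|^q$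 for all $\phi\in\mathcal{M}$, $\xi\in J^*\mathcal{M}^\circ$ (for any closed subspace $\mathcal{M}$ of $V$). $C_{K_0,\mathrm{tri}}$ is the constant from the triangle inequality-like property with $K=K_0$. Convention: terms with vanishing denominator (i.e. $w=0$ in $C_{K_0}$, or $\phi = 0$ or $\xi=0$ in the bound, where the trivial decomposition gives $0/0$) are read as $0$. *)

(* Defs.v *)
From HB Require Import structures.
From mathcomp Require Import all_boot all_order all_algebra.
From mathcomp Require Import all_classical all_reals all_analysis.

Set Implicit Arguments.
Unset Strict Implicit.
Unset Printing Implicit Defensive.

Import Order.TTheory GRing.Theory Num.Theory.
Import numFieldNormedType.Exports.

Local Open Scope classical_set_scope.
Local Open Scope ring_scope.

Section Defs.
Context {R : realType} {V : completeNormedModType R}.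
Implicit Types (F : V -> R) (p : V -> R) (K M : set V) (q eps C : R).

Definition uniformly_convex : Prop :=
  forall e : R, 0 < e -> exists2 delta : R, 0 < delta &
    forall x y : V, `|x| = 1 -> `|y| = 1 -> e <= `|x - y| ->
      `|x + y| / 2 <= 1 - delta.

(* Equivalently rho(t) / t --> 0 as t --> 0, where rho(t) is the supremum of
   (|x + y| + |x - y|) / 2 - 1 over |x| = 1, |y| = t. *)
Definition uniformly_smooth : Prop :=
  forall e : R, 0 < e -> exists2 delta : R, 0 < delta &
    forall x y : V, `|x| = 1 -> `|y| <= delta ->
      (`|x + y| + `|x - y|) / 2 - 1 <= e * `|y|.

Definition subspace M : Prop :=
  M 0 /\ forall (a : R) (x y : V), M x -> M y -> M (a *: x + y).

Definition closed_subspace M : Prop := subspace M /\ closed M.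

(* A family x : 'I_N -> V is a decomposition of w along the family U. *)
Definition decomp (N : nat) (U : 'I_N -> set V) (w : V) : set ('I_N -> V) :=
  [set x | (forall j, U j (x j)) /\ \sum_(j < N) x j = w].

Definition sum_of (N : nat) (U : 'I_N -> set V) : set V :=
  [set w | exists x, decomp U w x].

(* The dual V^* consists of the continuous f : {linear V -> R^o}; on those
   the supremum below is taken over a bounded nonempty set. *)
Definition dual_norm (f : {linear V -> R^o}) : R :=
  sup [set `|f v| | v in [set v : V | `|v| <= 1]].

Definition annihilator M : set {linear V -> R^o} :=
  [set f | continuous f /\ forall v, M v -> f v = 0].

(* Only meaningful on continuous f, for which the element is unique when V is
   uniformly convex. *)
Definition dual_map (f : {linear V -> R^o}) : V :=
  get [set v : V | f v = dual_norm f * `|v| /\ `|v| = dual_norm f].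

(* The Gateaux derivative is required to be an element of V^*; the pairing
   of F'(v) with w is 'D_w F v. *)
Definition gateaux_differentiable F : Prop :=
  forall v : V,
    [/\ forall w, derivable (F : V -> R^o) v w,
        linear (fun w => 'D_w (F : V -> R^o) v : R^o) &
        continuous (fun w => 'D_w (F : V -> R^o) v : R^o)].

Definition bregman F (w v : V) : R :=
  F (v + w) - F v - 'D_w (F : V -> R^o) v.

Definition to_infinity_along p F : Prop :=
  forall A : R, exists r : R, forall v, r <= p v -> A <= F v.

Definition coercive F : Prop := to_infinity_along (fun v => `|v|) F.

Definition seminorm p : Prop :=
  (forall x y, p (x + y) <= p x + p y) /\
  (forall (a : R) x, p (a *: x) = `|a| * p x).

Definition seminorm_ker p : set V := [set v | p v = 0].

Definition semicoercive p F : Prop :=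
  [/\ seminorm p,
      continuous (p : V -> R^o),
      exists2 C : R, 0 < C &
        forall v, inf [set `|v + phi| | phi in seminorm_ker p] <= C * p v,
      forall v phi, seminorm_ker p phi -> F v = F (v + phi) &
      to_infinity_along p F].

Definition eps_norm p q eps (v : V) : R :=
  (p v `^ q + eps * `|v| `^ q) `^ q^-1.

Definition triangle_constant (N : nat) (U : 'I_N -> set V) F K C : Prop :=
  0 < C /\
  forall (j : 'I_N) (v vj wj : V), K v -> U j vj -> U j wj ->
    bregman F (vj + wj) v <= C * (bregman F vj v + bregman F wj v).

Definition triangle_like (N : nat) (U : 'I_N -> set V) F : Prop :=
  forall K, bounded_set K -> convex_set K -> exists C, triangle_constant U F K C.

(* At w = 0 the quotient is 0 / 0 = 0, since bregman F 0 v = 0. *)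
Definition locally_smooth (N : nat) (U : 'I_N -> set V) F q : Prop :=
  forall (j : 'I_N) (K Kj : set V),
    bounded_set K -> convex_set K ->
    bounded_set Kj -> convex_set Kj -> Kj `<=` U j -> Kj 0 ->
    (ereal_sup [set (bregman F w v / `|w| `^ q)%:E | v in K & w in Kj] < +oo)%E.

Definition splitting_constant q C : Prop :=
  0 < C /\
  forall M, closed_subspace M ->
    forall phi xi : V, M phi -> (dual_map @` annihilator M) xi ->
      `|phi| `^ q + `|xi| `^ q <= C * `|phi + xi| `^ q.

Definition sublevel F (u0 : V) : set V := [set v | F v <= F u0].

(* Suprema and infima are taken in \bar R. As x / 0 = 0, the quotients are 0
   for all decompositions when the denominator vanishes. *)

Definition stability_constant (N : nat) (U : 'I_N -> set V) p F0 F1 q eps K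
    : \bar R :=
  (q%:E * ereal_sup [set y | exists v w : V, [/\ K v, K (v + w)%R &
    y = ereal_inf [set
      ((\sum_(j < N) (bregman F0 (x j) v + eps * bregman F1 (x j) v))
         / eps_norm p q eps w `^ q)%R%:E | x in decomp U w]]])%E.

(* eps is deliberately not a parameter. *)
Definition stability_bound (N : nat) (U : 'I_N -> set V) p F0 F1 q Cq Ctri K
    : \bar R :=
  ((q * Cq)%:E * ereal_sup [set y | exists v phi xi : V,
    [/\ K v, seminorm_ker p phi,
        (dual_map @` annihilator (seminorm_ker p)) xi,
        K (v + phi + xi)%R &
    y = (Cq * Ctri)%:E *
          ereal_inf [set ((\sum_(j < N) bregman F1 (x j) v) / `|phi| `^ q)%R%:E
                     | x in decomp (fun j => U j `&` seminorm_ker p) phi]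
        + ereal_inf [set ((\sum_(j < N) bregman F0 (x j) v) / p xi `^ q
                          + Cq * Ctri *
                            ((\sum_(j < N) bregman F1 (x j) v) / `|xi| `^ q))%R%:E
                     | x in decomp U xi]]])%E.

End Defs.

Arguments uniformly_convex {R} V.
Arguments uniformly_smooth {R} V.
Arguments splitting_constant {R} V q C.

(* Main.v *)
Require Import Defs.
From HB Require Import structures.
From mathcomp Require Import all_boot all_order all_algebra.
From mathcomp Require Import all_classical all_reals all_analysis.
From mathcomp Require Import ring lra.

Set Implicit Arguments.
Unset Strict Implicit.
Unset Printing Implicit Defensive.

Import Order.TTheory GRing.Theory Num.Theory.
Import numFieldNormedType.Exports.

Local Open Scope classical_set_scope.
Local Open Scope ring_scope.

(** Write [N] for the kernel of the seminorm. A correction [w] splits along [N]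
    and the duality image of its annihilator as [w = phi + xi]: [xi] is the
    element of least norm in [w + N], which exists by uniform convexity, and the
    derivative of the norm at [xi], which exists by uniform smoothness, is a
    functional that vanishes on [N] and has [xi] as its dual element
    ([duality_decomposition]).

    Decompose [phi] inside the [U j] that meet [N], and [xi] freely, and add the
    two decompositions. The part [F0] does not see [phi], so its Bregman distances
    involve [xi] only and are measured against [p xi = p w]. The part [F1] is
    split by the triangle-like inequality; its Bregman distances carry the factor
    [eps], which is absorbed by the summand [eps * `|w| ^ q] of the weighted norm
    because both [`|phi|] and [`|xi|] are controlled by [`|w|]. Hence no
    [eps] is left in the quotient ([splitting_estimate]).

    For finiteness, semicoercivity, convexity and the invariance of [F0] under
    [N] bound [F0] from below, so coercivity of [F1] makes the sublevel set
    bounded ([sublevel_bounded]). The open mapping theorem for the sum map out of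
    the product of the [U j], and likewise of their intersections with [N], yields
    decompositions whose components are bounded by a multiple of the norm of the
    vector ([bounded_decomposition]); local smoothness then bounds each Bregman
    distance by the [q]-th power of that norm. For the quotient by [p xi ^ q] one
    also needs [`|xi| <= C * p xi]: this is semicoercivity, since [`|xi|] equals
    the distance of [xi] to [N] ([dual_map_annihilator_min]). *)

(** * Completeness and closed subspaces *)


Section CompleteNormed.
Context {R : realType} {V : completeNormedModType R}.
Implicit Types (A M : set V) (x y : V).

Lemma closure_normP A x :
  closure A x <-> forall e : R, 0 < e -> exists2 y, A y & `|x - y| < e.
Proof.
split=> [clA e e0|clA B /nbhs_ballP[e /= e0 eB]].
  have [y [Ay /=]] := clA _ (nbhsx_ballx x e e0).
  by rewrite -ball_normE => xy; exists y.
have [y Ay xy] := clA _ e0.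
by exists y; split=> //; apply: eB; rewrite -ball_normE.
Qed.

Lemma closed_norm A x : closed A ->
  (forall e : R, 0 < e -> exists2 y, A y & `|x - y| < e) -> A x.
Proof. by move=> cA xA; apply: cA; apply/closure_normP. Qed.

Lemma geometric_vanishes (c : R) (r : nat -> R) :
  (forall n, r n <= c * 2^-1 ^+ n) -> forall e, 0 < e -> exists n, r n < e.
Proof.
move=> rc e e0.
have h : ((fun n => c * 2^-1 ^+ n) : nat -> R) @ \oo --> (0 : R).
  rewrite -[0](mulr0 c); apply: cvgM; first exact: cvg_cst.
  by apply: cvg_expr; rewrite ger0_norm ?invr_ge0// invf_lt1// ltr1n.
move/cvgr0Pnorm_lt: h => /(_ e e0)[n _ /(_ n (leqnn n)) /= hn].
by exists n; apply: le_lt_trans hn; apply: le_trans (rc n) (ler_norm _).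
Qed.

Lemma complete_tail (u : nat -> V) (r : nat -> R) :
  (forall m n, (m <= n)%N -> `|u n - u m| <= r m) ->
  (forall e, 0 < e -> exists n, r n < e) ->
  exists l, forall m, `|l - u m| <= r m.
Proof.
move=> ur r0.
have cu : cauchy (u @ \oo).
  apply: cauchy_exP => e e0; have [n rn] := r0 e e0.
  exists (u n); exists n => // k /= nk; rewrite -ball_normE /=.
  by rewrite distrC; apply: le_lt_trans (ur _ _ nk) rn.
have /cvg_ex[l ul] : cvg (u @ \oo) by exact: cauchy_cvg.
exists l => m; apply/ler_addgt0Pr => e e0.
move: ul => /cvgrPdist_lt /(_ e e0)[n _ hn].
have /hn /= h1 : (maxn n m >= n)%N by rewrite leq_maxl.
have h2 := ur m (maxn n m) (leq_maxr _ _).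
have := ler_distD (u (maxn n m)) l (u m).
by move: h1 h2; lra.
Qed.

(** The Baire property of a closed set [M], by shrinking balls centred in [M]:
    this relative form avoids equipping [M] with a structure of its own. If no
    [A n] contained a trace of a ball on [M], one could choose successively
    smaller balls, the [n]-th step avoiding [A n]; the common point of
    these balls would lie in [M] but in no [A n]. *)
Lemma baire_closed M (A : nat -> set V) x0 :
  closed M -> M x0 -> (forall n, closed (A n)) -> M `<=` \bigcup_n A n ->
  exists n x r, [/\ M x, 0 < r & forall y, M y -> `|y - x| <= r -> A n y].
Proof.
move=> cM Mx0 cA MA; apply: contrapT => noball.
have step n (b : V * R) : exists b' : V * R, M b.1 -> 0 < b.2 ->
    [/\ M b'.1, 0 < b'.2, b'.2 <= b.2 / 2, `|b'.1 - b.1| <= b.2 / 2 &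
        forall z, `|z - b'.1| <= b'.2 -> ~ A n z].
  have [[Mb b0]|nb] := pselect (M b.1 /\ 0 < b.2); last first.
    by exists b => Mb b0; case: nb.
  have [y [My yb nAy]] : exists y, [/\ M y, `|y - b.1| <= b.2 / 2 & ~ A n y].
    apply: contrapT => ny; apply: noball.
    exists n, b.1, (b.2 / 2); split=> //; first by rewrite divr_gt0.
    by move=> y My yb; apply: contrapT => nAy; apply: ny; exists y.
  have [s s0 sA] : exists2 s : R, 0 < s & forall z, `|z - y| <= s -> ~ A n z.
    apply: contrapT => ns; apply: nAy; apply: closed_norm => // e e0.
    apply: contrapT => nz; apply: ns; exists (e / 2); first by rewrite divr_gt0.
    move=> z zy Az; apply: nz; exists z => //.
    by rewrite distrC; apply: le_lt_trans zy _; rewrite gtr_pMr// invf_lt1 ?ltr1n.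
  exists (y, Num.min s (b.2 / 2)) => _ _ /=; split=> //.
  - by rewrite lt_min s0 divr_gt0.
  - by rewrite ge_min lexx orbT.
  - by move=> z; rewrite le_min => /andP[/sA].
have [f fP] : exists f : nat -> V * R -> V * R, forall n b, M b.1 -> 0 < b.2 ->
    [/\ M (f n b).1, 0 < (f n b).2, (f n b).2 <= b.2 / 2,
        `|(f n b).1 - b.1| <= b.2 / 2 &
        forall z, `|z - (f n b).1| <= (f n b).2 -> ~ A n z].
  have /choice[g gP] : forall nb : nat * (V * R), exists b' : V * R,
      M nb.2.1 -> 0 < nb.2.2 ->
      [/\ M b'.1, 0 < b'.2, b'.2 <= nb.2.2 / 2, `|b'.1 - nb.2.1| <= nb.2.2 / 2 &
        forall z, `|z - b'.1| <= b'.2 -> ~ A nb.1 z].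
    by move=> [n b]; exact: step.
  by exists (fun n b => g (n, b)) => n b; exact: (gP (n, b)).
(* A pair is the centre and the radius of a ball. *)
pose b := fix b n := if n is n'.+1 then f n' (b n') else (x0, 1 : R).
have bP n : M (b n).1 /\ 0 < (b n).2.
  elim: n => [//|n [Mb b0]] /=.
  by have [] := fP n (b n) Mb b0.
have bS n : [/\ (b n.+1).2 <= (b n).2 / 2, `|(b n.+1).1 - (b n).1| <= (b n).2 / 2
    & forall z, `|z - (b n.+1).1| <= (b n.+1).2 -> ~ A n z].
  by have [Mb b0] := bP n; have [] := fP n (b n) Mb b0.
have rgeo n : (b n).2 <= 1 * 2^-1 ^+ n.
  elim: n => [|n IH]; first by rewrite expr0 mulr1.
  by have [h _ _] := bS n; rewrite exprS; move: h IH; lra.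
have tail m n : (m <= n)%N -> `|(b n).1 - (b m).1| <= (b m).2.
  move=> mn; have [_ bm0] := bP m.
  suff h : `|(b n).1 - (b m).1| <= (b m).2 - (b n).2.
    by apply: le_trans h _; have [_ bn0] := bP n; rewrite gerBl ltW.
  rewrite -(subnK mn); elim: (n - m)%N => [|k IH]; first by rewrite !subrr normr0.
  rewrite addSn; have [h1 h2 _] := bS (k + m)%N.
  have := ler_distD (b (k + m)%N).1 (b (k + m).+1).1 (b m).1.
  by move: h1 h2 IH; lra.
have [l lP] := complete_tail tail (geometric_vanishes rgeo).
have Ml : M l.
  apply: closed_norm => // e /(geometric_vanishes rgeo)[n bn].
  by exists (b n).1; [case: (bP n) | exact: le_lt_trans (lP n) bn].
have [n _ Anl] := MA l Ml.
(* The ball of index n.+1, which contains l, was chosen to avoid A n. *)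
by have [_ _ /(_ l (lP _))] := bS n.
Qed.

End CompleteNormed.

Section Subspaces.
Context {R : realType} {V : completeNormedModType R}.
Implicit Types (A M : set V) (x y : V).

Lemma subspaceZ M (a : R) x : Defs.subspace M -> M x -> M (a *: x).
Proof. by move=> [M0 Mlin] Mx; rewrite -[_ *: _]addr0; exact: Mlin. Qed.

Lemma subspaceD M x y : Defs.subspace M -> M x -> M y -> M (x + y).
Proof. by move=> [M0 Mlin] Mx My; rewrite -[x]scale1r; apply: Mlin. Qed.

Lemma subspaceN M x : Defs.subspace M -> M x -> M (- x).
Proof. by move=> sM Mx; rewrite -scaleN1r; exact: subspaceZ. Qed.

Lemma subspaceB M x y : Defs.subspace M -> M x -> M y -> M (x - y).
Proof. by move=> sM Mx My; apply: subspaceD => //; exact: subspaceN. Qed.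

Section Decompositions.
Context {N : nat} {W : 'I_N -> set V} (sW : forall j, Defs.subspace (W j)).

Lemma decomp0 : decomp W 0 (fun=> 0).
Proof. by split=> [j|]; [case: (sW j) | rewrite big1]. Qed.

Lemma decompD x y a b :
  decomp W x a -> decomp W y b -> decomp W (x + y) (fun j => a j + b j).
Proof.
move=> [Wa <-] [Wb <-]; split=> [j|]; first exact: subspaceD.
by rewrite big_split.
Qed.

Lemma decompZ (c : R) x a : decomp W x a -> decomp W (c *: x) (fun j => c *: a j).
Proof.
move=> [Wa <-]; split=> [j|]; first exact: subspaceZ.
by rewrite scaler_sumr.
Qed.

Lemma sum_of_subspace : Defs.subspace (sum_of W).
Proof.
split=> [|a x y [u ux] [v vy]]; first by exists (fun=> 0); exact: decomp0.
by exists (fun j => a *: u j + v j); apply: decompD => //; exact: decompZ.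
Qed.

End Decompositions.

(** * Bounded decompositions along closed subspaces *)

Section BoundedDecomposition.
Context {N : nat} {W : 'I_N -> set V}.
Hypothesis (cW : forall j, closed_subspace (W j)) (cM : closed (sum_of W)).
Let sW j : Defs.subspace (W j) := (cW j).1.

(** First half of the open mapping theorem: by Baire, the closure of the set of
    sums of vectors bounded by some [n] contains a ball of [sum_of W] around some
    [x0]. Subtracting approximations of [x0] from those of [x0 + t *: y] recentres
    the ball at [0], and rescaling reaches every [y]. *)
Lemma approximate_decomposition : exists2 c : R, 0 < c & forall y e,
  sum_of W y -> 0 < e -> exists x : 'I_N -> V, [/\ forall j, W j (x j),
    forall j, `|x j| <= c * `|y| & `|y - \sum_j x j| < e].
Proof.
pose B (n : nat) : set V := [set y | exists2 x, decomp W y x & forall j, `|x j| <= n%:R].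
have cov : sum_of W `<=` \bigcup_n closure (B n).
  move=> y [x xy]; exists (Num.truncn (\sum_j `|x j|)).+1 => //.
  apply: subset_closure; exists x => // j.
  apply: le_trans (ltW (truncnS_gt _)).
  by rewrite (bigD1 j)//= lerDl sumr_ge0.
have [n [x0 [r [Mx0 r0 ballP]]]] :=
  baire_closed cM (sum_of_subspace sW).1 (fun n => @closed_closure _ (B n)) cov.
(* The summand 1 only keeps the constant positive when n = 0. *)
exists (2 * n%:R / r + 1); first by rewrite ltr_wpDl// divr_ge0// ?mulr_ge0// ltW.
move=> y e My e0; have [->|y0] := eqVneq y 0.
  exists (fun=> 0); split=> [j|j|]; first by case: (sW j).
    by rewrite !normr0 mulr0.
  by rewrite big1// subrr normr0.
have ny0 : 0 < `|y| by rewrite normr_gt0.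
pose t := r / `|y|; have t0 : 0 < t by rewrite divr_gt0.
have clx0 : closure (B n) x0 by apply: ballP => //; rewrite subrr normr0 ltW.
have clx1 : closure (B n) (x0 + t *: y).
  apply: ballP; last by rewrite addrC addKr normrZ gtr0_norm// divfK// gt_eqF.
  by rewrite addrC; apply: (sum_of_subspace sW).2.
have te0 : 0 < t * e / 2 by rewrite divr_gt0// mulr_gt0.
have /closure_normP/(_ _ te0)[a [u [Wu ua] un] xa] := clx0.
have /closure_normP/(_ _ te0)[b [v [Wv vb] vn] xb] := clx1.
exists (fun j => t^-1 *: (v j - u j)); split=> [j|j|].
- by apply: subspaceZ => //; exact: subspaceB.
- rewrite normrZ gtr0_norm ?invr_gt0// invf_div mulrDl mul1r.
  apply: (@le_trans _ _ (2 * n%:R / r * `|y|)); last by rewrite lerDl ltW.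
  have -> : 2 * n%:R / r * `|y| = `|y| / r * (n%:R + n%:R) by ring.
  apply: ler_wpM2l; first by rewrite divr_ge0// ltW.
  by rewrite (le_trans (ler_normB _ _))// lerD.
- rewrite -scaler_sumr sumrB ua vb -(ltr_pM2l t0) -{1}(gtr0_norm t0) -normrZ.
  rewrite scalerBr scalerA divff ?gt_eqF// scale1r.
  have -> : t *: y - (b - a) = (x0 + t *: y - b) - (x0 - a).
    by rewrite !opprB [a - x0]addrC addrACA [x0 + _]addrC addrK [- b + a]addrC.
  by have := ler_normB (x0 + t *: y - b) (x0 - a); move: xa xb; lra.
Qed.

(** Second half of the open mapping theorem: approximate the residual of the
    previous approximation within half its norm, again and again. The components
    form geometric series, whose sums stay in the closed subspaces. *)
Lemma bounded_decomposition : exists2 c : R, 0 < c & forall y, sum_of W y ->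
  exists2 x, decomp W y x & forall j, `|x j| <= c * `|y|.
Proof.
have [c c0 cP] := approximate_decomposition.
exists (2 * c); first by rewrite mulr_gt0.
have /choice[g gP] : forall z, exists x : 'I_N -> V, sum_of W z ->
    [/\ forall j, W j (x j), forall j, `|x j| <= c * `|z|
      & `|z - \sum_j x j| <= `|z| / 2].
  move=> z; have [Mz|nMz] := pselect (sum_of W z); last by exists (fun=> 0).
  have [->|z0] := eqVneq z 0.
    exists (fun=> 0) => _; split=> [j|j|]; first by case: (sW j).
      by rewrite !normr0 mulr0.
    by rewrite big1// subrr normr0 mul0r.
  have [|x [? ? ?]] := cP z (`|z| / 2) Mz; first by rewrite divr_gt0// normr_gt0.
  by exists x => _; split=> //; exact: ltW.
move=> y My.
pose X := fix X n : 'I_N -> V :=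
  if n is n'.+1 then fun j => X n' j + g (y - \sum_i X n' i) j else fun=> 0.
pose z n := y - \sum_j X n j.
have XP n : (forall j, W j (X n j)) /\ sum_of W (z n).
  elim: n => [|n [WX Mz]].
    split=> [j|]; first by case: (sW j).
    by rewrite /z big1 ?subr0.
  have [Wg _ _] := gP _ Mz.
  have WX' j : W j (X n.+1 j) by apply: subspaceD.
  split=> //; apply: subspaceB => //; first exact: sum_of_subspace.
  by exists (X n.+1).
have zS n : `|z n.+1| <= `|z n| / 2.
  have [_ _] := gP _ (XP n).2.
  by rewrite /z /= big_split/= opprD addrA.
have zgeo n : `|z n| <= `|y| * 2^-1 ^+ n.
  elim: n => [|n IH]; first by rewrite /z big1 // subr0 expr0 mulr1.
  by rewrite exprS; move: (zS n) IH; lra.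
have tail j m n : (m <= n)%N -> `|X n j - X m j| <= 2 * c * `|z m|.
  move=> mn; suff h : `|X n j - X m j| <= 2 * c * (`|z m| - `|z n|).
    by apply: le_trans h _; apply: ler_wpM2l; [rewrite mulr_ge0// ltW | rewrite gerBl].
  rewrite -(subnK mn); elim: (n - m)%N => [|k IH].
    by rewrite !subrr normr0 mulr0.
  rewrite addSn; have [_ /(_ j) h _] := gP _ (XP (k + m)%N).2.
  have h2 := ler_wpM2l (ltW c0) (zS (k + m)%N).
  have := ler_distD (X (k + m)%N j) (X (k + m).+1 j) (X m j).
  have -> : X (k + m).+1 j - X (k + m)%N j = g (z (k + m)%N) j.
    by rewrite /= addrC addKr.
  by move: h h2 IH; lra.
have vanish (C : R) : forall e, 0 < e -> exists n, C * `|z n| < e.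
  apply: (@geometric_vanishes _ (`|C| * `|y|)) => n.
  apply: (@le_trans _ _ (`|C| * `|z n|)); first by rewrite ler_wpM2r// ler_norm.
  by rewrite -mulrA ler_wpM2l.
have /choice[L LP] : forall j, exists l, forall m, `|l - X m j| <= 2 * c * `|z m|.
  by move=> j; apply: complete_tail; [exact: tail | exact: vanish].
exists L; last by move=> j; have := LP j 0%N; rewrite subr0 /z big1 // subr0.
split=> [j|].
  apply: (closed_norm (cW j).2) => e e0; have [n nP] := vanish (2 * c) e e0.
  by exists (X n j); [exact: (XP n).1 | exact: le_lt_trans (LP j n) nP].
apply/eqP; rewrite eq_sym -subr_eq0 -normr_le0; apply/ler_addgt0Pr => e e0.
rewrite add0r; have [n nP] := vanish (1 + N%:R * (2 * c)) e e0.
apply: le_trans (ltW nP).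
have -> : y - \sum_j L j = z n - \sum_j (L j - X n j).
  by rewrite sumrB /z opprB addrA subrK.
apply: le_trans (ler_normB _ _) _; rewrite mulrDl mul1r lerD2l.
apply: le_trans (ler_norm_sum _ _ _) _.
apply: (@le_trans _ _ (\sum_(j < N) 2 * c * `|z n|)); first by apply: ler_sum.
by rewrite sumr_const card_ord -[leLHS]mulr_natl mulrA.
Qed.

End BoundedDecomposition.
End Subspaces.

(** * Elements of least norm *)

Section UniformConvexity.
Context {R : realType} {V : completeNormedModType R}.
Implicit Types (C M : set V) (x y : V).

Lemma convex_setP C : convex_set C <-> forall (t : R) x y,
  0 <= t -> t <= 1 -> C x -> C y -> C (t *: x + (1 - t) *: y).
Proof.
split=> [convC t x y t0 t1 Cx Cy|convC x y t]; last first.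
  by rewrite !inE => Cx Cy; exact: convC.
have t01 : Itv.spec (@Itv.num_sem R) (Itv.Real `[0%Z, 1%Z]) t.
  by rewrite /Itv.spec/= /Itv.num_sem/= num_real/= in_itv/= t0 t1.
by have := convC x y (Itv.mk t01); rewrite !inE; exact.
Qed.

Hypothesis hconvex : uniformly_convex V.

(** Two almost minimal elements of a convex set are close. Normalise them to
    [X] and [Y]: [X + Y] is a multiple of a convex combination of [x] and [y], so
    its norm is almost [2], and uniform convexity forbids [X] and [Y] to be far
    apart. *)
Lemma almost_minimal_close C (d e : R) : convex_set C ->
  (forall x, C x -> d <= `|x|) -> 0 <= d -> 0 < e ->
  exists2 eta : R, 0 < eta & forall x y, C x -> C y ->
    `|x| <= d + eta -> `|y| <= d + eta -> `|x - y| <= e.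
Proof.
move=> convC dC; rewrite le_eqVlt => /predU1P[<-|d0] e0.
  exists (e / 2) => [|x y _ _]; first by rewrite divr_gt0.
  by rewrite add0r => xe ye; have := ler_normB x y; lra.
have e'0 : 0 < e / (4 * d) by rewrite divr_gt0// mulr_gt0.
have [delta delta0 convV] := hconvex e'0.
pose h := Num.min (Num.min 1 delta) (e / (2 * d)).
have h0 : 0 < h by rewrite !lt_min ltr01 delta0 divr_gt0// mulr_gt0.
have [h1 hd he] : [/\ h <= 1, h <= delta & h <= e / (2 * d)].
  by rewrite /h !ge_min !lexx !orbT.
exists (d * h) => [|x y Cx Cy xd yd]; first by rewrite mulr_gt0.
rewrite leNgt; apply/negP => exy.
have [ax bx] := (dC x Cx, dC y Cy).
pose a := `|x|; pose b := `|y|.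
have a0 : 0 < a by apply: lt_le_trans ax.
have b0 : 0 < b by apply: lt_le_trans bx.
pose X := a^-1 *: x; pose Y := b^-1 *: y.
have nX : `|X| = 1 by rewrite normrZ gtr0_norm ?invr_gt0// mulVf// gt_eqF.
have nY : `|Y| = 1 by rewrite normrZ gtr0_norm ?invr_gt0// mulVf// gt_eqF.
have ab0 : 0 < a + b by rewrite addr_gt0.
have XY : d * (a^-1 + b^-1) <= `|X + Y|.
  have -> : X + Y = (a^-1 + b^-1) *: ((b / (a + b)) *: x + (1 - b / (a + b)) *: y).
    rewrite scalerDr !scalerA; congr (_ *: _ + _ *: _); field;
    by rewrite !gt_eqF.
  have ab'0 : 0 < a^-1 + b^-1 by rewrite addr_gt0// invr_gt0.
  rewrite normrZ gtr0_norm// mulrC ler_pM2l//; apply: dC.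
  move/convex_setP: convC; apply=> //.
    by rewrite divr_ge0// ltW.
  by rewrite ler_pdivrMr// mul1r lerDr ltW.
have inv1 : (1 + h)^-1 * 2 <= d * (a^-1 + b^-1).
  have inv z : 0 < z -> z <= d + d * h -> (1 + h)^-1 <= d * z^-1.
    move=> z0 zd; rewrite -[d * _]invrK lef_pV2 ?posrE ?invr_gt0 ?mulr_gt0 ?invr_gt0 ?addr_gt0//.
    by rewrite invfM invrK mulrC ler_pdivrMr//; move: zd; lra.
  by have := inv a a0 xd; have := inv b b0 yd; lra.
have eXY : e / (4 * d) <= `|X - Y|.
  have e1 : `|x - y| <= a * `|X - Y| + `|a - b|.
    have -> : x - y = a *: (X - Y) + (a - b) *: Y.
      rewrite scalerBr scalerBl addrA subrK !scalerA !divff ?gt_eqF//.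
      by rewrite !scale1r.
    by apply: le_trans (ler_normD _ _) _; rewrite [X in _ + X]normrZ nY mulr1 normrZ (gtr0_norm a0).
  have e2 : `|a - b| <= d * h.
    by rewrite ler_norml; move: xd yd ax bx; rewrite -/a -/b => *; apply/andP; split; lra.
  have e3 : a * `|X - Y| <= 2 * d * `|X - Y|.
    rewrite ler_wpM2r//; apply: le_trans xd _.
    by rewrite mulr_natl mulr2n lerD2l -[leRHS]mulr1 ler_pM2l.
  have e4 : d * h <= e / 2.
    move: he; rewrite -(ler_pM2l d0); congr (_ <= _); field.
    by rewrite gt_eqF.
  rewrite ler_pdivrMr ?mulr_gt0//; move: exy e1 e2 e3 e4; lra.
have := convV _ _ nX nY eXY.
have i0 : 0 < (1 + h)^-1 by rewrite invr_gt0 addr_gt0.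
have i1 : (1 + h)^-1 * (1 + h) = 1 by rewrite mulVf// gt_eqF// addr_gt0.
move: (1 + h)^-1 i0 i1 inv1 XY => i i0 i1 inv1 XY h2.
have i2 : i <= 1 - delta by lra.
have : i * (1 + h) <= (1 - delta) * (1 + delta).
  by apply: ler_pM => //; [exact: ltW | lra | lra].
rewrite i1; have : 0 < delta * delta by rewrite mulr_gt0.
lra.
Qed.

(** A minimising sequence is Cauchy by [almost_minimal_close]. *)
Lemma minimal_norm C : convex_set C -> closed C -> C !=set0 ->
  exists2 x, C x & forall y, C y -> `|x| <= `|y|.
Proof.
move=> convC cC [x0 Cx0].
pose S := [set `|y| | y in C]; pose d := inf S.
have S0 : S !=set0 by exists `|x0|, x0.
have Slb : has_lbound S by exists 0 => _ [y _ <-].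
have dC x : C x -> d <= `|x| by move=> Cx; apply: ge_inf => //; exists x.
have d0 : 0 <= d by apply: lb_le_inf => // _ [y _ <-].
have pow0 n : 0 < 2^-1 ^+ n :> R by rewrite exprn_gt0// invr_gt0.
have /choice[eta etaP] n : exists eta : R, 0 < eta /\ forall x y, C x -> C y ->
    `|x| <= d + eta -> `|y| <= d + eta -> `|x - y| <= 2^-1 ^+ n.
  by have [eta ? ?] := almost_minimal_close convC dC d0 (pow0 n); exists eta.
(* Decreasing thresholds: what is almost minimal at one step is so at all earlier
   ones, which is what comparing u n with u m requires. *)
pose theta := fix th n := if n is n'.+1
  then Num.min (th n') (Num.min (eta n) (2^-1 ^+ n)) else Num.min (eta 0) 1.
have theta0 n : 0 < theta n.
  by elim: n => [|n IH] /=; rewrite !lt_min ?IH ?(etaP _).1 ?ltr01 ?pow0.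
have thetaP n : theta n <= eta n /\ theta n <= 2^-1 ^+ n.
  by case: n => [|n] /=; rewrite ?expr0 !ge_min !lexx !orbT.
have theta_dec m n : (m <= n)%N -> theta n <= theta m.
  move=> mn; rewrite -(subnK mn); elim: (n - m)%N => // k IH.
  by rewrite addSn; apply: le_trans IH; rewrite /= ge_min lexx.
have /choice[u uP] n : exists u, C u /\ `|u| <= d + theta n.
  have [|_ [y Cy <-] yd] := @inf_adherent _ S (theta n) (theta0 n) _.
    by split.
  by exists y; split=> //; exact: ltW.
have tail m n : (m <= n)%N -> `|u n - u m| <= 1 * 2^-1 ^+ m.
  move=> mn; rewrite mul1r; have [? _] := thetaP m.
  apply: (etaP m).2; [exact: (uP n).1|exact: (uP m).1| |].
    apply: le_trans (uP n).2 _; rewrite lerD2l; apply: le_trans (theta_dec _ _ mn) _.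
    by [].
  by apply: le_trans (uP m).2 _; rewrite lerD2l.
have van (c : R) : forall e, 0 < e -> exists n, c * 2^-1 ^+ n < e.
  exact: (@geometric_vanishes _ c).
have [l lP] := complete_tail tail (van 1).
exists l.
  apply: closed_norm => // e e0; have [n ne] := van 1 e e0.
  by exists (u n); [exact: (uP n).1 | exact: le_lt_trans (lP n) ne].
move=> y /dC; apply: le_trans; apply/ler_addgt0Pr => e e0.
have [n ne] := van 2 e e0.
have := ler_normD (l - u n) (u n); rewrite subrK.
by have := lP n; have := (uP n).2; have := (thetaP n).2; lra.
Qed.

End UniformConvexity.

(** * The duality map and the annihilator decomposition *)

Section Functionals.
Context {R : realType} {V : completeNormedModType R}.
Implicit Types (f : {linear V -> R^o}) (M : set V) (x y h k : V).

Lemma functional_of (f : V -> R^o) (c : R) : linear f -> (forall h, `|f h| <= c * `|h|) ->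
  exists g : {linear V -> R^o}, (forall h, g h = f h) /\ continuous g.
Proof.
move=> lf fc.
pose g : {linear V -> R^o} :=
  HB.pack f (GRing.isLinear.Build R V R^o *:%R f lf).
exists g; split=> //; apply: bounded_linear_continuous; apply/linear_boundedP.
exists c; split; first exact: num_real.
by move=> r cr x; apply: le_trans (fc x) _; rewrite ler_wpM2r// ltW.
Qed.

Lemma dual_norm_has_sup f : continuous f ->
  has_sup [set `|f v| | v in [set v : V | `|v| <= 1]].
Proof.
move=> /(_ 0) /continuous_linear_bounded /linear_boundedP[c [_ fc]].
split; first by exists `|f 0|, 0; rewrite //= normr0.
exists (`|c| + 1) => _ [v /= v1 <-].
apply: le_trans (fc (`|c| + 1) _ v) _; first by rewrite (le_lt_trans (ler_norm _))// ltrDl.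
by rewrite -[leRHS]mulr1 ler_wpM2l// addr_ge0.
Qed.

Lemma dual_norm_ge0 f : continuous f -> 0 <= dual_norm f.
Proof.
move=> /dual_norm_has_sup[_ ubf]; apply: (@le_trans _ _ `|f 0|) => //.
by apply: ub_le_sup => //; exists 0; rewrite //= normr0.
Qed.

Lemma dual_norm_le f v : continuous f -> `|f v| <= dual_norm f * `|v|.
Proof.
move=> cf; have [_ ubf] := dual_norm_has_sup cf.
have [->|v0] := eqVneq v 0; first by rewrite linear0 !normr0 mulr0.
have nv0 : 0 < `|v| by rewrite normr_gt0.
rewrite -ler_pdivrMr//; apply: ub_le_sup => //.
exists (`|v|^-1 *: v); first by rewrite /= normrZ normfV normr_id mulVf// gt_eqF.
by rewrite linearZ/= normrM normfV normr_id mulrC.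
Qed.

Lemma dual_norm_ub f c : 0 <= c -> (forall h, `|f h| <= c * `|h|) -> dual_norm f <= c.
Proof.
move=> c0 fc; apply: ge_sup; first by exists `|f 0|, 0; rewrite //= normr0.
by move=> _ [v /= v1 <-]; apply: le_trans (fc v) _; rewrite -[leRHS]mulr1 ler_wpM2l.
Qed.

Section Duality.
Hypothesis hconvex : uniformly_convex V.

(** Two dual elements [v], [w] of [f] satisfy [f (v + w) = 2 * dual_norm f ^ 2],
    so their normalised sum has norm [2]: uniform convexity makes them equal. *)
Lemma dual_element_unique f v w : continuous f ->
  f v = dual_norm f * `|v| -> `|v| = dual_norm f ->
  f w = dual_norm f * `|w| -> `|w| = dual_norm f -> v = w.
Proof.
move=> cf fv nv fw nw; have := dual_norm_ge0 cf.
rewrite le_eqVlt => /predU1P[n0|n0].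
  by move: nv nw; rewrite -n0 => /normr0_eq0-> /normr0_eq0->.
apply/eqP; rewrite -subr_eq0 -normr_eq0; apply/negPn/negP => vw.
set n := dual_norm f in fv nv fw nw n0.
have e0 : 0 < `|v - w| / n by rewrite divr_gt0// lt_neqAle eq_sym vw/=.
have [delta delta0 convV] := hconvex e0.
have unit (z : V) : `|z| = n -> `|n^-1 *: z| = 1.
  by move=> nz; rewrite normrZ gtr0_norm ?invr_gt0// nz mulVf// gt_eqF.
have := convV _ _ (unit v nv) (unit w nw).
rewrite -scalerBr -scalerDr !normrZ gtr0_norm ?invr_gt0// mulrC lexx => /(_ isT).
have : 2 * n <= `|v + w|.
  rewrite -(ler_pM2l n0); apply: le_trans (dual_norm_le _ cf).
  by apply: le_trans (ler_norm _); rewrite linearD/= fv fw nv nw; lra.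
rewrite -ler_pdivlMr// => h; rewrite mulrC in h; lra.
Qed.

(** [f] attains its norm because the hyperplane [f v = dual_norm f ^ 2] has an
    element of least norm; uniform convexity thus replaces reflexivity. *)
Lemma dual_element_exists f : continuous f ->
  exists v, f v = dual_norm f * `|v| /\ `|v| = dual_norm f.
Proof.
move=> cf; have := dual_norm_ge0 cf.
rewrite le_eqVlt => /predU1P[n0|n0].
  by exists 0; rewrite linear0 normr0 mulr0 -n0.
set n := dual_norm f in n0 *.
pose C := [set v : V | f v = n ^+ 2].
have CZ v : 0 < f v -> C ((n ^+ 2 / f v) *: v).
  by move=> fv; rewrite /C/= linearZ/= -[_ *: _]/(_ * _) divfK// gt_eqF.
have convC : convex_set C.
  apply/convex_setP => t x y _ _ Cx Cy; rewrite /C/= linearD !linearZ/= Cx Cy.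
  by rewrite -[_ *: _]/(t * _) -[_ *: _]/((1 - t) * _); ring.
have cC : closed C.
  apply: (@preimage_closed _ _ f [set r | r = n ^+ 2]) => [x _|]; first exact: cf.
  exact: closed_eq.
have almost c : 0 < c -> c < n -> exists2 v : V, `|v| <= 1 & c < f v.
  move=> c0 cn; have nc0 : 0 < n - c by rewrite subr_gt0.
  have [_ [v /= v1 <-]] := sup_adherent nc0 (dual_norm_has_sup cf).
  rewrite -[sup _]/n subKr => cfv; have [fv0|fv0] := leP 0 (f v).
    by exists v => //; rewrite ger0_norm in cfv.
  by exists (- v); rewrite ?normrN// linearN/= -ltr0_norm.
have [u0 _ fu0] : exists2 v : V, `|v| <= 1 & n / 2 < f v.
  by apply: almost; [rewrite divr_gt0 | lra].
have [v Cv vmin] := minimal_norm hconvex convC cC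
  (ex_intro _ _ (CZ u0 (lt_trans (divr_gt0 n0 (ltr0Sn _ 1)) fu0))).
have nv : n <= `|v|.
  rewrite -(ler_pM2l n0) -expr2 -[leLHS]Cv; apply: le_trans (ler_norm _) _.
  exact: dual_norm_le.
have v0 : 0 < `|v| by apply: lt_le_trans nv.
have vn : `|v| <= n.
  rewrite leNgt; apply/negP => nltv.
  have c0 : 0 < n ^+ 2 / `|v| by rewrite divr_gt0// exprn_gt0.
  have [|u u1 cu] := almost _ c0.
    by rewrite ltr_pdivrMr// expr2 ltr_pM2l.
  have fu0' : 0 < f u by apply: lt_trans cu.
  have := vmin _ (CZ u fu0').
  rewrite normrZ gtr0_norm ?divr_gt0 ?exprn_gt0// leNgt => /negP; apply.
  apply: (@le_lt_trans _ _ (n ^+ 2 / f u)).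
    by rewrite -[leRHS]mulr1 ler_wpM2l// divr_ge0 ?exprn_ge0// ltW.
  by rewrite ltr_pdivrMr// mulrC -ltr_pdivrMr.
have nvE : `|v| = n by apply/eqP; rewrite eq_le vn nv.
by exists v; rewrite nvE Cv expr2.
Qed.

Lemma dual_map_spec f : continuous f ->
  f (dual_map f) = dual_norm f * `|dual_map f| /\ `|dual_map f| = dual_norm f.
Proof.
move=> /dual_element_exists ex.
exact: (@getPex _ [set v : V | f v = dual_norm f * `|v| /\ `|v| = dual_norm f] ex).
Qed.

Lemma dual_map_eq f v : continuous f ->
  f v = dual_norm f * `|v| -> `|v| = dual_norm f -> dual_map f = v.
Proof.
by move=> cf fv nv; have [fd nd] := dual_map_spec cf; apply: dual_element_unique nv.
Qed.

(** A functional that annihilates [M] cannot tell [xi] from [xi + phi], and [xi]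
    realises its norm. *)
Lemma dual_map_annihilator_min M xi phi :
  (dual_map @` annihilator M) xi -> M phi -> `|xi| <= `|xi + phi|.
Proof.
move=> [f [cf fM] <-] Mphi; have [fd nd] := dual_map_spec cf.
have := dual_norm_ge0 cf; rewrite le_eqVlt => /predU1P[n0|n0].
  by rewrite nd -n0.
rewrite -(ler_pM2l n0) -fd; apply: le_trans (dual_norm_le _ cf).
by rewrite linearD/= (fM _ Mphi) addr0 ler_norm.
Qed.

Lemma dual_map_annihilator0 M : (dual_map @` annihilator M) 0.
Proof.
have [||z [zE cz]] := @functional_of (fun=> 0) 0.
- by move=> a h k; rewrite scaler0 addr0.
- by move=> h; rewrite normr0 mul0r.
have nz : dual_norm z = 0.
  apply/eqP; rewrite eq_le dual_norm_ge0// andbT dual_norm_ub// => h.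
  by rewrite zE normr0 mul0r.
exists z; first by split=> // *; rewrite zE.
by apply: dual_map_eq => //; rewrite ?zE ?nz ?normr0 ?mul0r.
Qed.

(** Taking [M] to be the whole space and [xi = 0] shows that the constant is at
    least [1]. *)
Lemma splitting_constant_ge1 q Cq (w : V) :
  0 < q -> splitting_constant V q Cq -> w != 0 -> 1 <= Cq.
Proof.
move=> q0 [_ split_le] w0.
have cT : closed_subspace [set: V] by split; [split|exact: closedT].
have := split_le _ cT w 0 Logic.I (dual_map_annihilator0 _).
rewrite addr0 normr0 powR0 ?gt_eqF// addr0.
by rewrite -[leLHS]mul1r ler_pM2r// powR_gt0// normr_gt0.
Qed.

End Duality.

Section Smoothness.
Hypothesis hsmooth : uniformly_smooth V.

(** The functional is the one-sided derivative of the norm at [x], written as the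
    infimum of the difference quotients. Convexity makes it sublinear and uniform
    smoothness makes it odd, hence linear. On [M] it is nonnegative, because [x] is
    of least norm in [x + M], so being odd it vanishes there. *)
Lemma norming_functional_unit M x : Defs.subspace M -> `|x| = 1 ->
  (forall m, M m -> 1 <= `|x + m|) ->
  exists s : V -> R^o, [/\ linear s, forall h, `|s h| <= `|h|, s x = 1 &
    forall m, M m -> s m = 0].
Proof.
move=> sM x1 xM.
pose Q h := [set (`|x + t *: h| - 1) / t | t in [set t : R | 0 < t]].
pose s h := inf (Q h).
have Qlb h t : 0 < t -> - `|h| <= (`|x + t *: h| - 1) / t.
  move=> t0; rewrite ler_pdivlMr// mulNr mulrC -(gtr0_norm t0) -normrZ gtr0_norm//.
  by have := ler_normB (x + t *: h) (t *: h); rewrite addrK x1; lra.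
have Q0 h : Q h !=set0 by exists ((`|x + 1 *: h| - 1) / 1), 1 => //=.
have sle h t : 0 < t -> s h <= (`|x + t *: h| - 1) / t.
  move=> t0; apply: ge_inf; last by exists t.
  by exists (- `|h|) => _ [r /= r0 <-]; exact: Qlb.
have les h c : (forall t, 0 < t -> c <= (`|x + t *: h| - 1) / t) -> c <= s h.
  by move=> hc; apply: lb_le_inf => // _ [t /= t0 <-]; exact: hc.
have subadd h k : s (h + k) <= s h + s k.
  rewrite -lerBlDr; apply: (les) => t t0; rewrite lerBlDr -lerBlDl; apply: (les) => r r0.
  rewrite lerBlDl.
  (* With this step length the quotient for h + k is at most the sum of the
     quotients for h with step t and for k with step r. *)
  have tr0 : 0 < t + r by rewrite addr_gt0.
  apply: le_trans (sle _ (t * r / (t + r)) _) _; first by rewrite divr_gt0// mulr_gt0.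
  have -> : x + (t * r / (t + r)) *: (h + k) =
      (r / (t + r)) *: (x + t *: h) + (t / (t + r)) *: (x + r *: k).
    rewrite !scalerDr addrACA -scalerDl !scalerA.
    have -> : r / (t + r) + t / (t + r) = 1 by field; rewrite gt_eqF.
    have -> : r / (t + r) * t = t * r / (t + r) by rewrite mulrAC [r * t]mulrC.
    by rewrite scale1r [t / _ * r]mulrAC.
  rewrite ler_pdivrMr; last by rewrite divr_gt0// mulr_gt0.
  have -> : ((`|x + t *: h| - 1) / t + (`|x + r *: k| - 1) / r) * (t * r / (t + r)) =
     r / (t + r) * `|x + t *: h| + t / (t + r) * `|x + r *: k| - 1.
    by field; rewrite !gt_eqF.
  rewrite lerD2r; apply: le_trans (ler_normD _ _) _; rewrite !normrZ.
  by rewrite !gtr0_norm ?mulr_gt0 ?invr_gt0.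
have s_le h : s h <= `|h|.
  apply: le_trans (sle h 1 ltr01) _; rewrite scale1r divr1.
  by have := ler_normD x h; rewrite x1; lra.
have s0 : s 0 = 0.
  apply/eqP; rewrite eq_le; apply/andP; split; first by have := s_le 0; rewrite normr0.
  by apply: (les) => t t0; have := Qlb 0 t t0; rewrite normr0 oppr0.
have sN h : s (- h) = - s h.
  apply/eqP; rewrite -addr_eq0 eq_le; apply/andP; split; last first.
    by have := subadd (- h) h; rewrite addNr s0.
  have [->|h0] := eqVneq h 0; first by rewrite oppr0 s0 addr0.
  have nh0 : 0 < `|h| by rewrite normr_gt0.
  apply/ler_addgt0Pr => e e0; rewrite add0r.
  have e'0 : 0 < e / (2 * `|h|) by rewrite divr_gt0// mulr_gt0.
  have [delta delta0 smV] := hsmooth e'0.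
  pose t := delta / `|h|; have t0 : 0 < t by rewrite divr_gt0.
  have nth : `|t *: h| = delta by rewrite normrZ gtr0_norm// divfK// gt_eqF.
  have := smV x (t *: h) x1; rewrite nth lexx => /(_ isT) sm.
  have := sle (- h) t t0; rewrite scalerN => h1; have h2 := sle h t t0.
  apply: le_trans (lerD h1 h2) _; rewrite -mulrDl ler_pdivrMr//.
  have -> : e * t = 2 * (e / (2 * `|h|) * delta).
    by rewrite /t; field; rewrite gt_eqF.
  by move: sm; lra.
have sD h k : s (h + k) = s h + s k.
  apply/eqP; rewrite eq_le subadd/=.
  by have := subadd (h + k) (- k); rewrite addrK sN; lra.
have sZp a h : 0 < a -> s (a *: h) = a * s h.
  have half b k : 0 < b -> s (b *: k) <= b * s k.
    move=> b0; rewrite -ler_pdivrMl//; apply: (les) => t t0.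
    rewrite ler_pdivrMl//; apply: le_trans (sle _ (t / b) _) _; first by rewrite divr_gt0.
    rewrite scalerA divfK ?gt_eqF// invf_div.
    by rewrite mulrCA.
  move=> a0; apply/eqP; rewrite eq_le half//=.
  have := half a^-1 (a *: h); rewrite invr_gt0 => /(_ a0).
  by rewrite scalerA mulVf ?gt_eqF// scale1r ler_pdivlMl.
have sZ a h : s (a *: h) = a * s h.
  have [a0|a0|->] := ltgtP a 0; [|exact: sZp|by rewrite scale0r mul0r].
  apply: oppr_inj; have := sZp (- a) h; rewrite oppr_gt0 scaleNr sN mulNr.
  exact.
exists s; split.
- by move=> a h k; rewrite sD sZ.
- by move=> h; rewrite ler_norml s_le andbT; apply: (les) => t; exact: Qlb.
- apply/eqP; rewrite eq_le; apply/andP; split; first by rewrite -x1.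
  apply: (les) => t t0; rewrite -{1}[x]scale1r -scalerDl normrZ x1 mulr1.
  by rewrite ler_pdivlMr// mul1r gtr0_norm ?addr_gt0//; lra.
- have s_ge0 m : M m -> 0 <= s m.
    move=> Mm; apply: (les) => t t0; apply: divr_ge0; last exact: ltW.
    rewrite subr_ge0; apply: xM.
    exact: subspaceZ.
  move=> m Mm; apply/eqP; rewrite eq_le s_ge0// andbT -oppr_ge0 -sN.
  by apply: s_ge0; exact: subspaceN.
Qed.

Lemma norming_functional M xi : Defs.subspace M ->
  (forall m, M m -> `|xi| <= `|xi + m|) ->
  exists f : {linear V -> R^o}, [/\ continuous f, forall h, `|f h| <= `|xi| * `|h|,
    f xi = `|xi| ^+ 2 & forall m, M m -> f m = 0].
Proof.
move=> sM ximin; have [->|xi0] := eqVneq xi 0.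
  have [|h|f [fE cf]] := @functional_of (fun=> 0) 0.
  - by move=> a h k; rewrite scaler0 addr0.
  - by rewrite normr0 mul0r.
  by exists f; split=> // *; rewrite fE ?normr0 ?mul0r ?expr0n.
have nxi : 0 < `|xi| by rewrite normr_gt0.
have [s [ls sb sx sM0]] : exists s : V -> R^o, [/\ linear s,
    forall h, `|s h| <= `|h|, s (`|xi|^-1 *: xi) = 1 & forall m, M m -> s m = 0].
  apply: norming_functional_unit => //.
    by rewrite normrZ normfV normr_id mulVf// gt_eqF.
  move=> m Mm; rewrite -(ler_pM2l nxi) mulr1 -[leRHS](congr1 (fun c => c * _) (normr_id xi)).
  rewrite -normrZ scalerDr scalerA divff ?gt_eqF// scale1r; apply: ximin.
  exact: subspaceZ.
have [|h|f [fE cf]] := @functional_of (fun h => `|xi| * s h) `|xi|.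
- by move=> a h k; rewrite ls mulrDr -![_ *: _]/(_ * _) mulrCA.
- by rewrite normrM normr_id ler_wpM2l.
have sxi : s xi = `|xi|.
  have := ls `|xi| (`|xi|^-1 *: xi) 0; rewrite !addr0 scalerA divff ?gt_eqF// scale1r sx.
  by move=> ->; rewrite sM0 ?addr0; [rewrite -[_ *: _]/(_ * _) mulr1|case: sM].
exists f; split=> //.
- by move=> h; rewrite fE normrM normr_id ler_wpM2l.
- by rewrite fE sxi expr2.
- by move=> m /sM0; rewrite fE => ->; rewrite mulr0.
Qed.

Hypothesis hconvex : uniformly_convex V.

(** The component [xi] is the element of least norm of [w + M]. *)
Lemma duality_decomposition M w : closed_subspace M ->
  exists phi xi, [/\ M phi, (dual_map @` annihilator M) xi & w = phi + xi].
Proof.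
move=> [sM cM].
pose C := [set x : V | M (w - x)].
have convC : convex_set C.
  apply/convex_setP => t x y _ _ Cx Cy; rewrite /C/=.
  have -> : w - (t *: x + (1 - t) *: y) = t *: (w - x) + (1 - t) *: (w - y).
    rewrite !scalerBr addrACA -scalerDl addrC addrCA subrr addr0 scale1r addrC.
    by rewrite opprD.
  by apply: sM.2 => //; exact: subspaceZ.
have cC : closed C.
  apply: (@preimage_closed _ _ (fun x => w - x) M) => // x _.
  by apply: cvgB; [exact: cvg_cst | exact: cvg_id].
have [|xi Cxi ximin] := minimal_norm hconvex convC cC.
  by exists w; rewrite /C/= subrr; case: sM.
exists (w - xi), xi; split=> //; last by rewrite subrK.
have [|f [cf fb fxi fM]] := @norming_functional M xi sM.
  move=> m Mm; apply: ximin; rewrite /C/= opprD addrA.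
  exact: subspaceB.
have nf : dual_norm f = `|xi|.
  apply/eqP; rewrite eq_le dual_norm_ub//=.
  have [->|xi0] := eqVneq xi 0; first by rewrite normr0 dual_norm_ge0.
  have nxi : 0 < `|xi| by rewrite normr_gt0.
  have := dual_norm_le xi cf; rewrite fxi normrX normr_id expr2.
  by rewrite ler_pM2r.
by exists f => //; apply: dual_map_eq => //; rewrite nf// fxi expr2.
Qed.

End Smoothness.
End Functionals.

(** * Bregman distances and sublevel sets *)

Section Bregman.
Context {R : realType} {V : completeNormedModType R}.
Implicit Types (F : V -> R) (v w : V).

Section Differentiable.
Variable F : V -> R.
Hypothesis dF : gateaux_differentiable F.

Lemma bregman0 v : bregman F 0 v = 0.
Proof.
have [_ lD _] := dF v.
have /eqP := lD 1 0 0; rewrite !scale1r addr0 -subr_eq0 opprD addrA subrr sub0r oppr_eq0.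
by move=> /eqP D0; rewrite /bregman addr0 subrr D0 subr0.
Qed.

Lemma gateaux_bounded v :
  exists2 c : R, 0 <= c & forall w, `|'D_w (F : V -> R^o) v| <= c * `|w|.
Proof.
have [_ lD cD] := dF v.
pose g : {linear V -> R^o} := HB.pack (fun w => 'D_w (F : V -> R^o) v : R^o)
  (GRing.isLinear.Build R V R^o *:%R _ lD).
exists (dual_norm g); first exact: dual_norm_ge0.
by move=> w; exact: (@dual_norm_le _ _ g w).
Qed.

Hypothesis cF : convex_function [set: V] F.

Lemma convex_line v w (t : R) : 0 <= t -> t <= 1 ->
  F (v + t *: w) <= F v + t * (F (v + w) - F v).
Proof.
move=> t0 t1.
have t01 : Itv.spec (@Itv.num_sem R) (Itv.Real `[0%Z, 1%Z]) t.
  by rewrite /Itv.spec/= /Itv.num_sem/= num_real/= in_itv/= t0 t1.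
have := cF (Itv.mk t01) (in_setT (v + w)) (in_setT v).
have -> : conv (Itv.mk t01) (v + w : convex_lmodType V) v = v + t *: w.
  rewrite /conv/= scalerDr scalerBl scale1r addrC addrA subrK.
  by rewrite addrC.
rewrite convRE/= /unstable.onem => /le_trans; apply; lra.
Qed.

Lemma bregman_ge0 w v : 0 <= bregman F w v.
Proof.
have [/(_ w) dw _ _] := dF v.
rewrite /bregman subr_ge0; apply/ler_addgt0Pr => e e0.
have : h^-1 *: ((F : V -> R^o) (h *: w + v) - F v) @[h --> 0^'] --> 'D_w (F : V -> R^o) v.
  exact: dw.
move=> /cvgrPdist_lt/(_ e e0)/nbhs_ballP[d /= d0 dP].
pose t := Num.min (d / 2) 1.
have t0 : 0 < t by rewrite lt_min divr_gt0/=.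
have t1 : t <= 1 by rewrite ge_min lexx orbT.
have td : t < d by rewrite gt_min ltr_pdivrMr// ltr_pMr// ltr1n.
have := dP t; rewrite -ball_normE/= sub0r normrN gtr0_norm// gt_eqF//.
move=> /(_ td isT) /ltr_distlDr D.
apply: le_trans (ltW D) _; rewrite lerD2r -[_ *: _]/(_ * _) mulrC ler_pdivrMr//.
by rewrite [t *: w + v]addrC; have := convex_line v w (ltW t0) t1; lra.
Qed.

End Differentiable.

(** Directions in which [F] is invariant contribute neither to the increment of
    [F] nor to its derivative. *)
Lemma bregman_invariant F (M : set V) : (forall v phi, M phi -> F v = F (v + phi)) ->
  (forall (t : R) phi, M phi -> M (t *: phi)) ->
  forall w phi v, M phi -> bregman F (phi + w) v = bregman F w v.
Proof.
move=> FM MZ w phi v Mphi; rewrite /bregman; congr (_ - _ - _).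
  by rewrite [phi + w]addrC addrA -(FM (v + w) phi Mphi).
rewrite /derive; suff -> : (fun h : R => h^-1 *: ((F \o shift v) (h *: (phi + w)) - F v)) =
  (fun h : R => h^-1 *: (((F : V -> R^o) \o shift v) (h *: w) - F v)) by [].
apply/funext => h /=; rewrite [h *: (_ + _)]scalerDr [h *: phi + _]addrC addrAC.
by rewrite -(FM (h *: w + v) (h *: phi) (MZ h _ Mphi)).
Qed.

(** Where [p] is large, [F] is large. Where [p] is bounded, semicoercivity and the
    invariance of [F] allow one to move into a ball by adding a kernel element, and
    there the tangent at [0] bounds [F] from below. *)
Lemma semicoercive_bounded_below p F : gateaux_differentiable F ->
  convex_function [set: V] F -> semicoercive p F -> exists m, forall v, m <= F v.
Proof.
move=> dF cF [[pD pZ] _ [C C0 pC] Fker Finf].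
have [r rP] := Finf 0.
have [c c0 cP] := gateaux_bounded dF 0.
exists (Num.min 0 (F 0 - c * (C * r + 1))) => v.
have [/rP Fv|pv] := leP r (p v); first by rewrite ge_min Fv.
have [|_ [phi /= pphi <-] phiP] :=
  @inf_adherent _ [set `|v + phi| | phi in seminorm_ker p] 1 ltr01.
  split; last by exists 0 => _ [phi _ <-].
  exists `|v + 0|, 0 => //; rewrite /seminorm_ker/=.
  by have := pZ 0 0; rewrite scale0r normr0 mul0r.
rewrite (Fker v phi pphi) ge_min; apply/orP; right.
have := bregman_ge0 dF cF (v + phi) 0; rewrite /bregman add0r.
have := cP (v + phi); rewrite ler_norml => /andP[+ _].
have : c * `|v + phi| <= c * (C * r + 1).
  apply: ler_wpM2l => //; apply: le_trans (ltW phiP) _; rewrite lerD2r.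
  by apply: le_trans (pC v) _; rewrite ler_pM2l// ltW.
lra.
Qed.

Lemma sublevel_bounded (F0 F1 : V -> R) (eps : R) u0 : 0 < eps ->
  (exists m, forall v, m <= F0 v) -> coercive F1 ->
  exists rho : R, forall v, sublevel (fun v => F0 v + eps * F1 v) u0 v -> `|v| <= rho.
Proof.
move=> eps0 [m mP] coF1.
have [r rP] := coF1 ((F0 u0 + eps * F1 u0 - m) / eps + 1).
exists r => v; rewrite /sublevel/= => vu; rewrite leNgt; apply/negP => /ltW/rP.
rewrite -(ler_pM2l eps0) mulrDr mulrCA divff ?gt_eqF// !mulr1.
by have := mP v; lra.
Qed.

Lemma sublevel_convex (F0 F1 : V -> R) (eps : R) u0 : 0 < eps ->
  convex_function [set: V] F0 -> convex_function [set: V] F1 ->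
  convex_set (sublevel (fun v => F0 v + eps * F1 v) u0).
Proof.
move=> eps0 c0 c1 x y t; rewrite !inE /sublevel/= => hx hy.
have := c0 t x y (in_setT _) (in_setT _); have := c1 t x y (in_setT _) (in_setT _).
rewrite !convRE /= => h1 h0; have := ler_wpM2l (ltW eps0) h1.
have t0 : 0 <= t%:num by [].
have t1 : 0 <= 1 - t%:num by rewrite subr_ge0.
have := ler_wpM2l t0 hx; have := ler_wpM2l t1 hy; rewrite /unstable.onem in h0 *.
move: h0; set F0' := F0 _; set F1' := F1 _; lra.
Qed.

Lemma smoothness_constant (N : nat) (U : 'I_N -> set V) F q (K : set V) (rho : R) :
  (forall j, Defs.subspace (U j)) -> gateaux_differentiable F -> locally_smooth U F q ->
  (exists c : R, forall v, K v -> `|v| <= c) -> convex_set K ->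
  exists2 S : R, 0 <= S & forall j v w, K v -> U j w -> `|w| <= rho ->
    bregman F w v <= S * `|w| `^ q.
Proof.
Proof.
move=> sU dF sF [c cK] convK.
have bounded (A : set V) (r : R) : (forall v, A v -> `|v| <= r) -> bounded_set A.
  move=> Ar; exists r; split; first exact: num_real.
  by move=> s rs v Av; apply: le_trans (Ar v Av) (ltW rs).
have /choice[S SP] : forall j, exists s : R, forall v w, K v -> U j w -> `|w| <= rho ->
    bregman F w v <= `|s| * `|w| `^ q.
  move=> j; pose Kj := [set w : V | U j w /\ `|w| <= `|rho|].
  have convKj : convex_set Kj.
    apply/convex_setP => t x y t0; rewrite -subr_ge0 => t1 [Ux xr] [Uy yr]; split.
      by apply: (sU j).2 => //; exact: subspaceZ.
    apply: le_trans (ler_normD _ _) _.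
    rewrite !normrZ (ger0_norm t0) (ger0_norm t1).
    by have := ler_wpM2l t0 xr; have := ler_wpM2l t1 yr; lra.
  have Kj0 : Kj 0 by split; [case: (sU j) | rewrite normr0].
  have bKj : bounded_set Kj by apply: (bounded _ `|rho|) => w [].
  have := sF j K Kj (bounded _ _ cK) convK bKj convKj (fun w h => h.1) Kj0.
  set E := [set _ | _ in K & _ in Kj] => supE.
  have [s sE] : exists s : R, (ereal_sup E <= s%:E)%E.
    by case: (ereal_sup E) supE => // [s _|_]; [exists s | exists 0; exact: leNye].
  exists s => v w Kv Uw wrho.
  have [->|w0] := eqVneq w 0; first by rewrite bregman0// mulr_ge0// powR_ge0.
  have : ((bregman F w v / `|w| `^ q)%:E <= s%:E)%E.
    apply: le_trans sE; apply: ereal_sup_ubound; exists v => //; exists w => //.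
    by split=> //; apply: le_trans wrho (ler_norm _).
  rewrite lee_fin ler_pdivrMr ?powR_gt0 ?normr_gt0// => /le_trans; apply.
  by rewrite ler_wpM2r ?powR_ge0// ler_norm.
exists (\sum_j `|S j|) => [|j v w Kv Uw wrho]; first by rewrite sumr_ge0.
apply: le_trans (SP j v w Kv Uw wrho) _.
apply: ler_wpM2r; first exact: powR_ge0.
by rewrite (bigD1 j)//= lerDl sumr_ge0.
Qed.
End Bregman.

(** * Removing eps from the quotient *)

Section CombinationOfInfima.
Context {R : realType} {S T : Type}.
Variables (A : set S) (B : set T) (f : S -> R) (g : T -> R) (k : R).
Hypotheses (k0 : 0 <= k) (f0 : forall x, A x -> 0 <= f x) (g0 : forall y, B y -> 0 <= g y).
Let inff := ereal_inf [set (f x)%:E | x in A].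
Let infg := ereal_inf [set (g y)%:E | y in B].

Lemma inf_combination_ge0 : (0 <= k%:E * inff + infg)%E.
Proof.
apply: adde_ge0; first (apply: mule_ge0; first by rewrite lee_fin).
  by apply: le_ereal_inf_tmp => _ [x Ax <-]; rewrite lee_fin f0.
by apply: le_ereal_inf_tmp => _ [y By <-]; rewrite lee_fin g0.
Qed.

Lemma inf_combination_le x y : A x -> B y ->
  (k%:E * inff + infg <= (k * f x + g y)%:E)%E.
Proof.
move=> Ax By; rewrite EFinD EFinM; apply: leeD.
  by apply: lee_wpmul2l; [rewrite lee_fin | apply: ereal_inf_lbound; exists x].
by apply: ereal_inf_lbound; exists y.
Qed.

Lemma le_inf_combination X : A !=set0 -> B !=set0 ->
  (forall x y, A x -> B y -> (X <= (k * f x + g y)%:E)%E) ->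
  (X <= k%:E * inff + infg)%E.
Proof.
move=> [x0 Ax0] [y0 By0] XP.
have finf : inff \is a fin_num.
  rewrite ge0_fin_numE; last by apply: le_ereal_inf_tmp => _ [x Ax <-]; rewrite lee_fin f0.
  by apply: le_lt_trans (ltry (f x0)); apply: ereal_inf_lbound; exists x0.
have fing : infg \is a fin_num.
  rewrite ge0_fin_numE; last by apply: le_ereal_inf_tmp => _ [y By <-]; rewrite lee_fin g0.
  by apply: le_lt_trans (ltry (g y0)); apply: ereal_inf_lbound; exists y0.
apply/lee_addgt0Pr => e e0.
have e'0 : 0 < e / (k + 1) by rewrite divr_gt0// ltr_wpDl.
have [_ [x Ax <-] xP] := lb_ereal_inf_adherent e'0 finf.
have [_ [y By <-] yP] := lb_ereal_inf_adherent e'0 fing.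
apply: le_trans (XP x y Ax By) _.
rewrite -/inff in xP; rewrite -/infg in yP.
have [[r1 E1] [r2 E2]] : (exists r, inff = r%:E) /\ (exists r, infg = r%:E).
  by split; [exists (fine inff)|exists (fine infg)]; rewrite fineK.
move: xP yP; rewrite E1 E2 -EFinM -!EFinD !lte_fin lee_fin => xP yP.
have h := ler_wpM2l k0 (ltW xP).
have : (k + 1) * (e / (k + 1)) = e by rewrite mulrC divfK// gt_eqF// ltr_wpDl.
by move: h yP; move: (e / (k + 1)) => d; rewrite mulrDr mulrDl mul1r; lra.
Qed.

End CombinationOfInfima.

Section Estimates.
Context {R : realType} {V : completeNormedModType R}.
Implicit Types (F : V -> R) (v w phi xi : V) (p : V -> R).

Lemma seminorm_ge0 p x : seminorm p -> 0 <= p x.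
Proof.
move=> [pD pZ]; have p0 : p 0 = 0 by have := pZ 0 0; rewrite scale0r normr0 mul0r.
have pN : p (- x) = p x by rewrite -scaleN1r pZ normrN normr1 mul1r.
by have := pD x (- x); rewrite subrr p0 pN; lra.
Qed.

Lemma seminorm_ker_add p phi xi : seminorm p -> seminorm_ker p phi -> p (phi + xi) = p xi.
Proof.
rewrite /seminorm_ker/= => -[pD pZ] p0.
have pN : p (- phi) = 0 by rewrite -scaleN1r pZ p0 mulr0.
have := pD phi xi; have := pD (- phi) (phi + xi); rewrite addKr p0 pN !add0r => h1 h2.
by apply/eqP; rewrite eq_le h1 h2.
Qed.

Lemma seminorm_ker_subspace p : seminorm p -> Defs.subspace (seminorm_ker p).
Proof.
move=> sp; have [pD pZ] := sp; split=> [|a x y px py].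
  by rewrite /seminorm_ker/=; have := pZ 0 0; rewrite scale0r normr0 mul0r.
by rewrite /seminorm_ker/= seminorm_ker_add// /seminorm_ker/= pZ px mulr0.
Qed.

Lemma seminorm_ker_closed p : seminorm p -> continuous (p : V -> R^o) ->
  closed_subspace (seminorm_ker p).
Proof.
move=> sp cp; split; first exact: seminorm_ker_subspace.
apply: (@preimage_closed _ _ (p : V -> R^o) [set r | r = 0]) => [x _|]; first exact: cp.
exact: closed_eq.
Qed.

Lemma eps_norm_powR p q (eps : R) w : q != 0 -> 0 <= eps ->
  eps_norm p q eps w `^ q = p w `^ q + eps * `|w| `^ q.
Proof.
move=> q0 eps0; rewrite /eps_norm -powRrM mulVf// powRr1//.
by rewrite addr_ge0 ?mulr_ge0 ?powR_ge0.
Qed.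

Lemma bregman_sum_bound (N : nat) F v (x : 'I_N -> V) (s k t q : R) :
  0 < q -> 0 <= s -> 0 <= k -> 0 <= t -> (forall j, bregman F (x j) v <= s * `|x j| `^ q) ->
  (forall j, `|x j| <= k * t) ->
  (\sum_j bregman F (x j) v) / t `^ q <= N%:R * (s * k `^ q).
Proof.
move=> q0 s0 k0; rewrite le_eqVlt => /predU1P[<- _ _|t0 Fx xk].
  by rewrite powR0 ?gt_eqF// invr0 mulr0 mulr_ge0// mulr_ge0// powR_ge0.
rewrite ler_pdivrMr ?powR_gt0//.
apply: (@le_trans _ _ (\sum_(j < N) s * (k `^ q * t `^ q))).
  apply: ler_sum => j _; apply: le_trans (Fx j) _; apply: ler_wpM2l => //.
  rewrite -powRM// ?(ltW t0)//; apply: ge0_ler_powR => //; rewrite ?nnegrE ?(ltW q0)//.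
  by rewrite mulr_ge0// ltW.
by rewrite sumr_const card_ord -[leLHS]mulr_natl !mulrA.
Qed.

Section Splitting.
Context {N : nat} (U : 'I_N -> set V) (p F0 F1 : V -> R) (K : set V).
Context (q eps Cq Ctri : R).
Hypotheses (sU : forall j, Defs.subspace (U j)) (heps : 0 < eps) (hq : 1 < q).
Hypotheses (sp : seminorm p) (inv : forall v phi, seminorm_ker p phi -> F0 v = F0 (v + phi)).
Hypotheses (dF0 : gateaux_differentiable F0) (dF1 : gateaux_differentiable F1).
Hypotheses (cF0 : convex_function [set: V] F0) (cF1 : convex_function [set: V] F1).
Hypotheses (hCtri : triangle_constant U F1 K Ctri) (Cq0 : 0 < Cq).

(** [F0] does not see the components of [phi], and [eps] cancels against the
    weight of the norm, since [`|phi| ^ q] and [`|xi| ^ q] are at most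
    [Cq * `|w| ^ q]. *)
Lemma splitting_estimate v w phi xi x y :
  K v -> seminorm_ker p phi -> w = phi + xi ->
  `|phi| `^ q + `|xi| `^ q <= Cq * `|w| `^ q -> (p xi = 0 -> xi = 0) ->
  decomp (fun j => U j `&` seminorm_ker p) phi x -> decomp U xi y ->
  exists2 z, decomp U w z &
    (\sum_(j < N) (bregman F0 (z j) v + eps * bregman F1 (z j) v)) / eps_norm p q eps w `^ q
    <= Cq * Ctri * ((\sum_(j < N) bregman F1 (x j) v) / `|phi| `^ q)
       + ((\sum_(j < N) bregman F0 (y j) v) / p xi `^ q
          + Cq * Ctri * ((\sum_(j < N) bregman F1 (y j) v) / `|xi| `^ q)).
Proof.
move=> Kv Nphi wE split_le pxi0 [Wx xphi] [Uy yxi].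
have [Ctri0 tri] := hCtri.
have q0 : 0 < q by apply: lt_trans hq.
have sumF0 (u : 'I_N -> V) : 0 <= \sum_j bregman F0 (u j) v.
  by apply: sumr_ge0 => j _; exact: bregman_ge0.
have sumF1 (u : 'I_N -> V) : 0 <= \sum_j bregman F1 (u j) v.
  by apply: sumr_ge0 => j _; exact: bregman_ge0.
set a := (\sum_j bregman F0 (y j) v) / _; set b := (\sum_j bregman F1 (x j) v) / _.
set c := (\sum_j bregman F1 (y j) v) / _.
have [a0 b0 c0] : [/\ 0 <= a, 0 <= b & 0 <= c] by rewrite !divr_ge0 ?powR_ge0.
(* The quotients read 0 / 0 as 0, hence say nothing about a decomposition of the
   zero vector; such a decomposition is replaced by the trivial one. *)
pose trim (u : V) (e : 'I_N -> V) : 'I_N -> V := if u == 0 then fun=> 0 else e.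
pose x' := trim phi x; pose y' := trim xi y.
have trim_decomp (W : 'I_N -> set V) u e : (forall j, Defs.subspace (W j)) ->
    decomp W u e -> decomp W u (trim u e).
  by rewrite /trim => sW ue; case: eqVneq => // ->; exact: decomp0.
have [Wx' x'phi] : decomp (fun j => U j `&` seminorm_ker p) phi x'.
  apply: trim_decomp => // j; have [N0 Nlin] := seminorm_ker_subspace sp.
  split=> [|r u u' [? ?] [? ?]]; first by split=> //; case: (sU j).
  by split; [apply: (sU j).2 | apply: Nlin].
have [Uy' y'xi] : decomp U xi y' by apply: trim_decomp.
have sum0 F : gateaux_differentiable F -> \sum_(j < N) bregman F 0 v = 0.
  by move=> dF; rewrite big1// => j _; exact: bregman0.
have x'b : \sum_j bregman F1 (x' j) v <= `|phi| `^ q * b.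
  rewrite /x' /trim; case: eqVneq => [->|phi0].
    by rewrite sum0// mulr_ge0// powR_ge0.
  by rewrite mulrC divfK// gt_eqF// powR_gt0// normr_gt0.
have y'c : \sum_j bregman F1 (y' j) v <= `|xi| `^ q * c.
  rewrite /y' /trim; case: eqVneq => [->|xi0].
    by rewrite sum0// mulr_ge0// powR_ge0.
  by rewrite mulrC divfK// gt_eqF// powR_gt0// normr_gt0.
have y'a : \sum_j bregman F0 (y' j) v <= p xi `^ q * a.
  rewrite /y' /trim; case: eqVneq => [xi0|xi0].
    by rewrite sum0// mulr_ge0// powR_ge0.
  rewrite mulrC divfK// gt_eqF// powR_gt0// lt_neqAle seminorm_ge0// andbT.
  by apply: contra_neq xi0 => /esym; exact: pxi0.
pose z j := x' j + y' j; exists z.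
  split=> [j|]; first by apply: subspaceD => //; case: (Wx' j).
  by rewrite big_split/= x'phi y'xi.
have F0z j : bregman F0 (z j) v = bregman F0 (y' j) v.
  apply: (@bregman_invariant _ _ F0 (seminorm_ker p)) => //; last exact: (Wx' j).2.
  by move=> t u; apply: subspaceZ; exact: seminorm_ker_subspace.
have F1z : \sum_j bregman F1 (z j) v <=
    Ctri * (\sum_j bregman F1 (x' j) v + \sum_j bregman F1 (y' j) v).
  rewrite -big_split mulr_sumr; apply: ler_sum => j _.
  by apply: (tri j) => //; exact: (Wx' j).1.
rewrite eps_norm_powR ?gt_eqF//; last exact: ltW.
have -> : p w = p xi by rewrite wE (seminorm_ker_add xi sp Nphi).
set P := p xi `^ q; set W := `|w| `^ q in split_le *.
have [P0 W0] : 0 <= P /\ 0 <= W by rewrite !powR_ge0.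
have phiW : `|phi| `^ q <= Cq * W by apply: le_trans split_le; rewrite lerDl powR_ge0.
have xiW : `|xi| `^ q <= Cq * W by apply: le_trans split_le; rewrite lerDr powR_ge0.
set E := Cq * Ctri * b + (a + Cq * Ctri * c).
have CC0 : 0 <= Cq * Ctri by rewrite mulr_ge0// ltW.
have E0 : 0 <= E by rewrite !addr_ge0// mulr_ge0.
have D_ge0 : 0 <= P + eps * W by rewrite addr_ge0// mulr_ge0// ltW.
have [->|D_neq0] := eqVneq (P + eps * W) 0; first by rewrite invr0 mulr0.
have D0 : 0 < P + eps * W by rewrite lt_def D_neq0.
rewrite ler_pdivrMr// big_split/= -mulr_sumr.
under eq_bigr do rewrite F0z.
(* The factor `|w| ^ q gained here absorbs eps. *)
have s1 : \sum_j bregman F1 (z j) v <= Ctri * (Cq * W * b + Cq * W * c).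
  apply: le_trans F1z _; apply: ler_wpM2l; first exact: ltW.
  apply: lerD; [apply: le_trans x'b _|apply: le_trans y'c _]; exact: ler_wpM2r.
have s2 := ler_wpM2l (ltW heps) s1.
apply: le_trans (lerD y'a s2) _.
have -> : P * a + eps * (Ctri * (Cq * W * b + Cq * W * c)) =
  E * (P + eps * W) - (P * (E - a) + eps * W * a) by rewrite /E; ring.
rewrite gerBl addr_ge0// mulr_ge0//; last by rewrite mulr_ge0// ltW.
by rewrite /E addrCA addrAC subrr add0r addr_ge0// mulr_ge0.
Qed.

End Splitting.
End Estimates.

(** * The bound and its finiteness *)

Section StabilityBound.
Context {R : realType} {V : completeNormedModType R} {N : nat}.
Context (U : 'I_N -> set V) (p F0 F1 : V -> R) (eps q Cq Ctri : R) (K : set V).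
Hypotheses (hconvex : uniformly_convex V) (hsmooth : uniformly_smooth V).
Hypotheses (hU : forall j, closed_subspace (U j)) (hUsum : sum_of U = [set: V]).
Hypotheses (heps : 0 < eps) (hq : 1 < q).
Hypotheses (dF0 : gateaux_differentiable F0) (dF1 : gateaux_differentiable F1).
Hypotheses (cF0 : convex_function [set: V] F0) (cF1 : convex_function [set: V] F1).
Hypothesis F0semi : semicoercive p F0.
Let M := seminorm_ker p.
Hypothesis hker : M = sum_of (fun j => U j `&` M).
Hypotheses (hCq : splitting_constant V q Cq) (hCtri : triangle_constant U F1 K Ctri).

Let sp : seminorm p. Proof. by case: F0semi. Qed.
Let closedM : closed_subspace M.
Proof. by case: F0semi => _ cp _ _ _; exact: seminorm_ker_closed. Qed.
Let sU j : Defs.subspace (U j). Proof. by case: (hU j). Qed.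
Let Cq0 : 0 < Cq. Proof. by case: hCq. Qed.
Let CC0 : 0 <= Cq * Ctri.
Proof. by case: hCtri => Ctri0 _; rewrite mulr_ge0// ltW. Qed.
Let q0 : 0 < q. Proof. exact: lt_trans hq. Qed.

Let kernel_quotient (v phi : V) (x : 'I_N -> V) : R :=
  (\sum_j bregman F1 (x j) v) / `|phi| `^ q.

Let dual_quotient (v xi : V) (y : 'I_N -> V) : R :=
  (\sum_j bregman F0 (y j) v) / p xi `^ q +
  Cq * Ctri * ((\sum_j bregman F1 (y j) v) / `|xi| `^ q).

Let bracket (v phi xi : V) : \bar R := ((Cq * Ctri)%:E *
    ereal_inf [set (kernel_quotient v phi x)%:E
              | x in decomp (fun j => U j `&` M) phi]
  + ereal_inf [set (dual_quotient v xi y)%:E | y in decomp U xi])%E.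

Let bracket_sup := ereal_sup [set b | exists v phi xi : V,
  [/\ K v, M phi, (dual_map @` annihilator M) xi, K (v + phi + xi)
    & b = bracket v phi xi]].

Let boundE : stability_bound U p F0 F1 q Cq Ctri K = ((q * Cq)%:E * bracket_sup)%E.
Proof. by []. Qed.

Let kernel_quotient_ge0 v phi (x : 'I_N -> V) : 0 <= kernel_quotient v phi x.
Proof. by rewrite divr_ge0 ?powR_ge0// sumr_ge0// => j _; exact: bregman_ge0. Qed.

Let dual_quotient_ge0 v xi (y : 'I_N -> V) : 0 <= dual_quotient v xi y.
Proof.
rewrite addr_ge0//; last by apply: mulr_ge0 => //; exact: kernel_quotient_ge0.
by rewrite divr_ge0 ?powR_ge0// sumr_ge0// => j _; exact: bregman_ge0.
Qed.

Let le_bracket_sup v phi xi : K v -> M phi -> (dual_map @` annihilator M) xi ->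
  K (v + phi + xi) -> (bracket v phi xi <= bracket_sup)%E.
Proof. by move=> *; apply: ereal_sup_ubound; exists v, phi, xi. Qed.

Let bracket_sup_ge0 u : K u -> (0 <= bracket_sup)%E.
Proof.
move=> Ku; apply: (@le_trans _ _ (bracket u 0 0)); first exact: inf_combination_ge0.
have [[M0 _] _] := closedM; apply: le_bracket_sup => //; last by rewrite !addr0.
exact: dual_map_annihilator0.
Qed.

(** Semicoercivity bounds the distance of [xi] to the kernel, which is [`|xi|]. *)
Let norm_le_seminorm : exists2 C : R, 0 < C &
  forall xi, (dual_map @` annihilator M) xi -> `|xi| <= C * p xi.
Proof.
case: F0semi => _ _ [C C0 pC] _ _; exists C => // xi Jxi.
apply: le_trans (pC xi); apply: lb_le_inf.
  by have [[M0 _] _] := closedM; exists `|xi + 0|, 0.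
by move=> _ [phi Mphi <-]; exact: (dual_map_annihilator_min hconvex Jxi).
Qed.

(** [splitting_estimate] gives the bound without the outer factor [Cq], which can
    only enlarge it: [Cq >= 1] as soon as the space has a nonzero vector, and the
    supremum is nonnegative. *)
Lemma stability_le_bound u : K u ->
  (stability_constant U p F0 F1 q eps K <= stability_bound U p F0 F1 q Cq Ctri K)%E.
Proof.
move=> Ku; have B0 := bracket_sup_ge0 Ku.
rewrite boundE /stability_constant EFinM -muleA; apply: lee_wpmul2l.
  by rewrite lee_fin ltW.
apply: ge_ereal_sup => _ [v [w [Kv Kvw ->]]].
(* For w = 0 the quotient is 0; in the zero space, Cq may be less than 1. *)
have [w0|w0] := eqVneq w 0.
  apply: (@le_trans _ _ 0%:E); last by apply: mule_ge0 => //; rewrite lee_fin ltW.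
  apply: ereal_inf_lbound; exists (fun=> 0); first by rewrite w0; exact: decomp0.
  by rewrite big1 ?mul0r// => j _; rewrite !bregman0// mulr0 addr0.
apply: (@le_trans _ _ bracket_sup); last first.
  rewrite -[leLHS]mul1e; apply: lee_wpmul2r => //.
  by rewrite lee_fin (splitting_constant_ge1 hconvex q0 hCq w0).
have [phi [xi [Mphi Jxi wE]]] := duality_decomposition hsmooth hconvex w closedM.
apply: le_trans (le_bracket_sup Kv Mphi Jxi _); last by rewrite -addrA -wE.
have decM : exists x, decomp (fun j => U j `&` M) phi x by move: Mphi; rewrite {1}hker.
have decU : exists y, decomp U xi y by have : [set: V] xi by []; rewrite -hUsum.
apply: le_inf_combination => // x y xP yP.
have pxi0 : p xi = 0 -> xi = 0.
  have [C _ /(_ _ Jxi)] := norm_le_seminorm.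
  by move=> + pxi; rewrite pxi mulr0 normr_le0 => /eqP.
have := hCq.2 _ closedM _ _ Mphi Jxi; rewrite -wE => splitw.
have inv : forall v phi, M phi -> F0 v = F0 (v + phi) by case: F0semi.
have [z zw zle] := splitting_estimate sU heps hq sp inv dF0 dF1 cF0
  cF1 hCtri Cq0 Kv Mphi wE splitw pxi0 xP yP.
apply: le_trans (ereal_inf_lbound _) _; first by exists z.
by rewrite lee_fin.
Qed.

Hypotheses (hsm0 : locally_smooth U F0 q) (hsm1 : locally_smooth U F1 q).

(** The infima are bounded by the values at decompositions with components of
    comparable norm, where all quotients are bounded by local smoothness. *)
Lemma stability_bound_finite (rho : R) :
  (forall v, K v -> `|v| <= rho) -> convex_set K ->
  (stability_bound U p F0 F1 q Cq Ctri K < +oo)%E.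
Proof.
move=> rhoP convK.
have [C C0 xi_le] := norm_le_seminorm.
have cWM j : closed_subspace (U j `&` M).
  have [sM cM] := closedM; split; last by apply: closedI => //; case: (hU j).
  split=> [|r x y [? ?] [? ?]]; first by split; [case: (sU j)|case: sM].
  by split; [apply: (sU j).2 | apply: sM.2].
have [c1 c1_gt0 dec1] : exists2 c : R, 0 < c & forall y, M y ->
  exists2 x, decomp (fun j => U j `&` M) y x & forall j, `|x j| <= c * `|y|.
  by rewrite {1}hker; apply: bounded_decomposition => //; rewrite -hker; case: closedM.
have [c2 c2_gt0 dec2] : exists2 c : R, 0 < c & forall y,
  exists2 x, decomp U y x & forall j, `|x j| <= c * `|y|.
  have [|c c0 cP] := @bounded_decomposition _ _ _ U hU; first by rewrite hUsum; exact: closedT.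
  by exists c => // y; apply: cP; rewrite hUsum.
(* b bounds both components of w, whose norm is at most 2 * rho. *)
pose b := (Cq * (2 * rho) `^ q) `^ q^-1.
pose rho' := (c1 + c2) * b.
have b0 : 0 <= b by exact: powR_ge0.
have [S0 S00 S0P] := smoothness_constant rho' sU dF0 hsm0 (ex_intro _ rho rhoP) convK.
have [S1 S10 S1P] := smoothness_constant rho' sU dF1 hsm1 (ex_intro _ rho rhoP) convK.
pose bound := Cq * Ctri * (N%:R * (S1 * c1 `^ q)) +
  (N%:R * (S0 * (c2 * C) `^ q) + Cq * Ctri * (N%:R * (S1 * c2 `^ q))).
suff Bbound : (bracket_sup <= bound%:E)%E.
  rewrite boundE; apply: (@le_lt_trans _ _ ((q * Cq)%:E * bound%:E)%E).
    by apply: lee_wpmul2l => //; rewrite lee_fin mulr_ge0// ltW.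
  by rewrite -EFinM ltry.
apply: ge_ereal_sup => _ [v [phi [xi [Kv Mphi Jxi Kw ->]]]].
have part_le (u : V) : `|u| `^ q <= Cq * `|phi + xi| `^ q -> `|u| <= b.
  move=> ule; have wrho : `|phi + xi| <= 2 * rho.
    have -> : phi + xi = (v + phi + xi) - v by rewrite -[v + phi + xi]addrA [RHS]addrC addKr.
    apply: le_trans (ler_normB _ _) _.
    by have := rhoP _ Kv; have := rhoP _ Kw; lra.
  have -> : `|u| = (`|u| `^ q) `^ q^-1 by rewrite -powRrM divff ?gt_eqF// powRr1.
  apply: ge0_ler_powR; rewrite ?nnegrE ?invr_ge0 ?(ltW q0)// ?powR_ge0//.
    by rewrite mulr_ge0 ?powR_ge0// ltW.
  apply: le_trans ule _; rewrite ler_pM2l//; apply: ge0_ler_powR; rewrite ?nnegrE ?(ltW q0)//.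
  exact: le_trans (normr_ge0 _) wrho.
have splitw := hCq.2 _ closedM _ _ Mphi Jxi.
have phib : `|phi| <= b by apply: part_le; apply: le_trans splitw; rewrite lerDl powR_ge0.
have xib : `|xi| <= b by apply: part_le; apply: le_trans splitw; rewrite lerDr powR_ge0.
have [x xP xphi] := dec1 _ Mphi.
have [y yP yxi] := dec2 xi.
have x_small j : `|x j| <= rho'.
  apply: le_trans (xphi j) _; apply: ler_pM => //; first exact: ltW.
  by rewrite lerDl ltW.
have y_small j : `|y j| <= rho'.
  apply: le_trans (yxi j) _; apply: ler_pM => //; first exact: ltW.
  by rewrite lerDr ltW.
have Ux j : U j (x j) by case: xP => /(_ j)[].
have Uy j : U j (y j) by case: yP.
apply: le_trans (inf_combination_le (kernel_quotient v phi) (dual_quotient v xi) CC0 xP yP) _.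
rewrite lee_fin.
apply: lerD.
  apply: ler_wpM2l => //; apply: bregman_sum_bound => //; first exact: ltW.
  by move=> j; apply: S1P.
apply: lerD.
  apply: bregman_sum_bound => //.
  - by rewrite mulr_ge0// ltW.
  - exact: seminorm_ge0.
  - by move=> j; apply: S0P.
  - move=> j; apply: le_trans (yxi j) _; rewrite -mulrA ler_pM2l//.
    exact: xi_le.
apply: ler_wpM2l => //; apply: bregman_sum_bound => //; first exact: ltW.
by move=> j; apply: S1P.
Qed.

End StabilityBound.

Theorem theorem5p8 (R : realType) (V : completeNormedModType R)
  (hconvex : uniformly_convex V) (hsmooth : uniformly_smooth V)
  (N : nat) (U : 'I_N -> set V)
  (hU : forall j, closed_subspace (U j))
  (hUsum : sum_of U = [set: V])
  (eps : R) (heps : 0 < eps)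
  (F0 F1 : V -> R)
  (hF0diff : gateaux_differentiable F0)
  (hF1diff : gateaux_differentiable F1)
  (hF0conv : convex_function [set: V] F0)
  (hF1conv : convex_function [set: V] F1)
  (p : V -> R)
  (hF0semi : semicoercive p F0)
  (hF1coer : coercive F1)
  (hker : seminorm_ker p = sum_of (fun j => U j `&` seminorm_ker p))
  (htri : triangle_like U F1)
  (q : R) (hq : 1 < q)
  (hsm0 : locally_smooth U F0 q)
  (hsm1 : locally_smooth U F1 q)
  (u0 : V) :
  let K0 := sublevel (fun v => F0 v + eps * F1 v) u0 in
  forall (Cq : R) (hCq : splitting_constant V q Cq)
    (Ctri : R) (hCtri : triangle_constant U F1 K0 Ctri),
    (stability_constant U p F0 F1 q eps K0
       <= stability_bound U p F0 F1 q Cq Ctri K0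
     /\ stability_bound U p F0 F1 q Cq Ctri K0 < +oo)%E.
Proof.
move=> K0 Cq hCq Ctri hCtri; split.
  have Ku0 : K0 u0 by rewrite /K0 /sublevel/=.
  by apply: stability_le_bound Ku0.
have [rho rhoP] : exists rho : R, forall v, K0 v -> `|v| <= rho.
  apply: sublevel_bounded => //; exact: semicoercive_bounded_below hF0semi.
by apply: stability_bound_finite rhoP _ => //; exact: sublevel_convex.
Qed.
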